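(* For all sets of formulas $\Gamma \cup \{\phi\} \subseteq \mathcal{L}_{\Box\Diamond}$, the following are equivalent: (i) $\Gamma \vdash_{\mathsf{IM_{Calc}}} \phi$; (ii) $\Gamma \Vdash^{\mathrm{inm}} \phi$; (iii) $\Gamma \models \phi$; (iv) $\Gamma \vdash_{\mathsf{IM}} \phi$.
   Context: $\mathcal{L}_{\Box\Diamond}$ is the language $\phi ::= p_i \mid \bot \mid \phi\wedge\phi \mid \phi\vee\phi \mid \phi\to\phi \mid \Box\phi \mid \Diamond\phi$. $\mathsf{IFOM}$ is intuitionistic two-sorted first-order logic with sorts $\mathsf{s}$ (worlds) and $\mathsf{n}$ (neighbourhoods), binary predicates $\mathsf{N}$ (between $\mathsf{s}$ and $\mathsf{n}$) and $\mathsf{E}$ (between $\mathsf{n}$ and $\mathsf{s}$), and unary predicates $\mathsf{P}_i$ of sort $\mathsf{s}$; the standard translation is $\mathrm{st}_x(\Box\phi) = \exists a(x\mathsf{N}a \wedge \forall y(a\mathsf{E}y \to \mathrm{st}_y(\phi)))$, $\mathrm{st}_x(\Diamond\phi) = \forall a(x\mathsf{N}a \to \exists y(a\mathsf{E}y\wedge \mathrm{st}_y(\phi)))$, $\mathrm{st}_x(p_i)=\mathsf{P}_ix$, $\mathrm{st}_x(\bot)=(x\neq x)$, commuting with $\wedge,\vee,\to$. $\Gamma \vdash_{\mathsf{IM}} \phi$ means: in every $\mathsf{IFOM}$-structure (intuitionistic Kripke structure with increasing domains/predicates) at every world $w$ and every $d$ of sort $\mathsf{s}$ at $w$, if $\mathrm{st}_x(\Gamma)[d]$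 holds then $\mathrm{st}_x(\phi)[d]$ holds. $\Gamma\models\phi$ is the same condition stated via the direct interpretation of $\mathcal{L}_{\Box\Diamond}$-formulas at pairs $(w,x)$ of an $\mathsf{IFOM}$-structure. $\mathsf{IM_{Calc}}$ is the generalised Hilbert calculus consisting of intuitionistic propositional axioms plus the axioms $(\Box p\wedge\Diamond\neg p)\to\bot$ and $(\Box\top\to\Diamond p)\to\Diamond p$ (all substitution instances), with rules: element ($\Gamma\vdash\phi$ for $\phi\in\Gamma$), axiom ($\Gamma\vdash\psi$ for axiom instances $\psi$), modus ponens, and monotonicity rules: from $\emptyset\vdash\phi\to\psi$ infer $\Gamma\vdash\Box\phi\to\Box\psi$ and $\Gamma\vdash\Diamond\phi\to\Diamond\psi$. An intuitionistic neighbourhood model $(W,\leq,N,V)$ is a partial order $(W,\leq)$, a set $N$ of partial functions $a: W\rightharpoonup \mathcal{P}(W)$ whose domains are upsets, and a valuation into upsets; $w\Vdash\Box\phi$ iff there is $a\in N$ with $w\in\mathrm{dom}(a)$ such that for all $w'\geq w$, every $v\in a(w')$ satisfies $\phi$; $w\Vdash\Diamond\phi$ iff for all $w'\geq w$ and all $a\in N$ with $w'\in\mathrm{dom}(a)$ there is $v\in a(w')$ satisfying $\phi$; propositional connectives are interpreted intuitionistically. $\Gamma \Vdash^{\mathrm{inm}} \phi$ means every world of every intuitionistic neighbourhood model satisfying all of $\Gamma$ satisfies $\phi$. *)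

(* Defs.v *)
From Stdlib Require Import Relations Ensembles.

Set Implicit Arguments.
Unset Strict Implicit.

Declare Scope set_mem_scope.
Notation "x ∈ A" := (In _ A x) (at level 70, no associativity) : set_mem_scope.
Open Scope set_mem_scope.

Inductive form : Type :=
| Var (i : nat)
| Bot
| And (phi psi : form)
| Or (phi psi : form)
| Imp (phi psi : form)
| Box (phi : form)
| Dia (phi : form).

Definition Neg (phi : form) : form := Imp phi Bot.
Definition Top : form := Neg Bot.

Inductive axiom : form -> Prop :=
| ax_K phi psi : axiom (Imp phi (Imp psi phi))
| ax_S phi psi chi :
    axiom (Imp (Imp phi (Imp psi chi)) (Imp (Imp phi psi) (Imp phi chi)))
| ax_andI phi psi : axiom (Imp phi (Imp psi (And phi psi)))
| ax_andE1 phi psi : axiom (Imp (And phi psi) phi)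
| ax_andE2 phi psi : axiom (Imp (And phi psi) psi)
| ax_orI1 phi psi : axiom (Imp phi (Or phi psi))
| ax_orI2 phi psi : axiom (Imp psi (Or phi psi))
| ax_orE phi psi chi :
    axiom (Imp (Imp phi chi) (Imp (Imp psi chi) (Imp (Or phi psi) chi)))
| ax_botE phi : axiom (Imp Bot phi)
| ax_box_dia_neg phi : axiom (Imp (And (Box phi) (Dia (Neg phi))) Bot)
| ax_box_top_dia phi : axiom (Imp (Imp (Box Top) (Dia phi)) (Dia phi)).

Inductive calc : Ensemble form -> form -> Prop :=
| calc_el Gamma phi : phi ∈ Gamma -> calc Gamma phi
| calc_ax Gamma phi : axiom phi -> calc Gamma phi
| calc_mp Gamma phi psi :
    calc Gamma phi -> calc Gamma (Imp phi psi) -> calc Gamma psi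
| calc_mon_box Gamma phi psi :
    calc (Empty_set form) (Imp phi psi) ->
    calc Gamma (Imp (Box phi) (Box psi))
| calc_mon_dia Gamma phi psi :
    calc (Empty_set form) (Imp phi psi) ->
    calc Gamma (Imp (Dia phi) (Dia psi)).

Definition upset (W : Type) (le : relation W) (U : Ensemble W) : Prop :=
  forall w w', le w w' -> w ∈ U -> w' ∈ U.

Definition pfun (W : Type) : Type := W -> option (Ensemble W).

Definition dom (W : Type) (a : pfun W) : Ensemble W :=
  fun w => exists U, a w = Some U.

(** The set [a(w)]; it is empty when [w] is outside [dom a], so [dom] has to be
    consulted separately from membership in [app a w]. *)
Definition app (W : Type) (a : pfun W) (w : W) : Ensemble W :=
  fun v => exists U, a w = Some U /\ v ∈ U.

Record inm : Type := {
  inm_world :> Type;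
  inm_le : relation inm_world;
  inm_le_order : order inm_world inm_le;
  inm_N : Ensemble (pfun inm_world);
  inm_N_dom : forall a, a ∈ inm_N -> upset inm_le (dom a);
  inm_V : nat -> Ensemble inm_world;
  inm_V_upset : forall i, upset inm_le (inm_V i)
}.

Arguments inm_le {M} w w' : rename.
Arguments inm_N M : rename, clear implicits.
Arguments inm_V M i : rename, clear implicits.

Fixpoint inm_force (M : inm) (w : M) (phi : form) : Prop :=
  match phi with
  | Var i => w ∈ inm_V M i
  | Bot => False
  | And phi psi => inm_force w phi /\ inm_force w psi
  | Or phi psi => inm_force w phi \/ inm_force w psi
  | Imp phi psi =>
      forall w' : M, inm_le w w' -> inm_force w' phi -> inm_force w' psi
  | Box phi =>
      exists a, a ∈ inm_N M /\ w ∈ dom a /\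
        forall w' : M, inm_le w w' ->
        forall v : M, v ∈ app a w' -> inm_force v phi
  | Dia phi =>
      forall w' : M, inm_le w w' ->
      forall a, a ∈ inm_N M -> w' ∈ dom a ->
        exists v : M, v ∈ app a w' /\ inm_force v phi
  end.

Definition inm_consequence (Gamma : Ensemble form) (phi : form) : Prop :=
  forall (M : inm) (w : M),
    (forall psi, psi ∈ Gamma -> inm_force w psi) -> inm_force w phi.

(** The increasing domains of the two sorts are subsets of fixed carriers, so
    that an element of the domain at [w] is literally an element of the domain
    at every [w'] above [w].  Domains are allowed to be empty. *)
Record structure : Type := {
  world :> Type;
  le : relation world;
  le_order : order world le;
  carrier_s : Type;
  carrier_n : Type;
  dom_s : world -> Ensemble carrier_s;
  dom_n : world -> Ensemble carrier_n;
  dom_s_incr : forall w w', le w w' -> Included _ (dom_s w) (dom_s w');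
  dom_n_incr : forall w w', le w w' -> Included _ (dom_n w) (dom_n w');
  int_N : world -> carrier_s -> carrier_n -> Prop;
  int_E : world -> carrier_n -> carrier_s -> Prop;
  int_P : nat -> world -> Ensemble carrier_s;
  int_N_dom : forall w x a, int_N w x a -> x ∈ dom_s w /\ a ∈ dom_n w;
  int_E_dom : forall w a x, int_E w a x -> a ∈ dom_n w /\ x ∈ dom_s w;
  int_P_dom : forall i w, Included _ (int_P i w) (dom_s w);
  int_N_incr : forall w w' x a, le w w' -> int_N w x a -> int_N w' x a;
  int_E_incr : forall w w' a x, le w w' -> int_E w a x -> int_E w' a x;
  int_P_incr : forall i w w', le w w' -> Included _ (int_P i w) (int_P i w')
}.

Arguments le {M} w w' : rename.
Arguments dom_s {M} w : rename.
Arguments dom_n {M} w : rename.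
Arguments int_N {M} w x a : rename.
Arguments int_E {M} w a x : rename.
Arguments int_P {M} i w : rename.

Fixpoint holds (M : structure) (w : M) (x : carrier_s M) (phi : form) : Prop :=
  match phi with
  | Var i => x ∈ int_P i w
  | Bot => False
  | And phi psi => holds w x phi /\ holds w x psi
  | Or phi psi => holds w x phi \/ holds w x psi
  | Imp phi psi =>
      forall w' : M, le w w' -> holds w' x phi -> holds w' x psi
  | Box phi =>
      exists a, a ∈ dom_n w /\ int_N w x a /\
        forall w' : M, le w w' ->
        forall y, y ∈ dom_s w' -> int_E w' a y -> holds w' y phi
  | Dia phi =>
      forall w' : M, le w w' ->
      forall a, a ∈ dom_n w' -> int_N w' x a ->
        exists y, y ∈ dom_s w' /\ int_E w' a y /\ holds w' y phi
  end.

Definition structure_consequence (Gamma : Ensemble form) (phi : form) : Prop :=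
  forall (M : structure) (w : M) (d : carrier_s M), d ∈ dom_s w ->
    (forall psi, psi ∈ Gamma -> holds w d psi) -> holds w d phi.

(** [fo X A] is the type of formulas whose free variables of sort s are in [X]
    and whose free variables of sort n are in [A].  A quantifier binds the
    variable [None] of [option X] or [option A]. *)
Inductive fo (X A : Type) : Type :=
| FEqS (x y : X)
| FEqN (a b : A)
| FN (x : X) (a : A)
| FE (a : A) (x : X)
| FP (i : nat) (x : X)
| FBot
| FAnd (f g : fo X A)
| FOr (f g : fo X A)
| FImp (f g : fo X A)
| FAllS (f : fo (option X) A)
| FExS (f : fo (option X) A)
| FAllN (f : fo X (option A))
| FExN (f : fo X (option A)).

Arguments FEqS {X A} x y.
Arguments FEqN {X A} a b.
Arguments FN {X A} x a.
Arguments FE {X A} a x.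
Arguments FP {X A} i x.
Arguments FBot {X A}.
Arguments FAnd {X A} f g.
Arguments FOr {X A} f g.
Arguments FImp {X A} f g.
Arguments FAllS {X A} f.
Arguments FExS {X A} f.
Arguments FAllN {X A} f.
Arguments FExN {X A} f.

Definition FNeqS {X A : Type} (x y : X) : fo X A := FImp (FEqS x y) FBot.

Definition extend (X D : Type) (rho : X -> D) (d : D) (o : option X) : D :=
  match o with Some x => rho x | None => d end.

Fixpoint sat (M : structure) (X A : Type) (w : M)
    (rho : X -> carrier_s M) (sigma : A -> carrier_n M) (f : fo X A) : Prop :=
  match f with
  | FEqS x y => rho x = rho y
  | FEqN a b => sigma a = sigma b
  | FN x a => int_N w (rho x) (sigma a)
  | FE a x => int_E w (sigma a) (rho x)
  | FP i x => rho x ∈ int_P i w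
  | FBot => False
  | FAnd f g => sat w rho sigma f /\ sat w rho sigma g
  | FOr f g => sat w rho sigma f \/ sat w rho sigma g
  | FImp f g =>
      forall w' : M, le w w' -> sat w' rho sigma f -> sat w' rho sigma g
  | FAllS f =>
      forall w' : M, le w w' ->
      forall d, d ∈ dom_s w' -> sat w' (extend rho d) sigma f
  | FExS f => exists d, d ∈ dom_s w /\ sat w (extend rho d) sigma f
  | FAllN f =>
      forall w' : M, le w w' ->
      forall b, b ∈ dom_n w' -> sat w' rho (extend sigma b) f
  | FExN f => exists b, b ∈ dom_n w /\ sat w rho (extend sigma b) f
  end.

(** In the clauses for [Box] and [Dia], the sort-n variable [None] is the [a]
    of the translation and the sort-s variable [None] is its [y]. *)
Fixpoint st (X A : Type) (x : X) (phi : form) : fo X A :=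
  match phi with
  | Var i => FP i x
  | Bot => FNeqS x x
  | And phi psi => FAnd (st A x phi) (st A x psi)
  | Or phi psi => FOr (st A x phi) (st A x psi)
  | Imp phi psi => FImp (st A x phi) (st A x psi)
  | Box phi =>
      FExN (FAnd (FN x None)
                 (FAllS (FImp (FE None None) (st (option A) None phi))))
  | Dia phi =>
      FAllN (FImp (FN x None)
                  (FExS (FAnd (FE None None) (st (option A) None phi))))
  end.

(** [st_x(phi)[d]] at [w], where [x] is the only free variable. *)
Definition st_sat (M : structure) (w : M) (d : carrier_s M) (phi : form) : Prop :=
  sat w (fun _ : unit => d)
    (fun a : Datatypes.Empty_set => match a with end)
    (st Datatypes.Empty_set tt phi).

Definition st_consequence (Gamma : Ensemble form) (phi : form) : Prop :=
  forall (M : structure) (w : M) (d : carrier_s M), d ∈ dom_s w ->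
    (forall psi, psi ∈ Gamma -> st_sat w d psi) -> st_sat w d phi.

(* Main.v *)
(** The cycle is (i) -> (iii) -> (ii) -> (i), together with (iii) <-> (iv).

    (iii) -> (ii): in a structure an element [x] stays fixed while the world
    moves, whereas in a neighbourhood model the point itself moves.  Over a
    neighbourhood model [M] the elements are therefore taken to be names
    ("threads"), and a world of the structure records the current position in
    [M] of each thread created so far.  A new world moves one thread to an
    arbitrary point above its position, and creates fresh threads for all
    neighbours which that move makes necessary.

    (ii) -> (i): the worlds of the canonical model are prime theories tagged
    with a rank.  The ranks provide every world with strictly larger copies of
    itself, so that a neighbourhood refuting [Dia phi] at one world can be
    modified there alone: above that world it is not constrained by [phi], and
    hence it forces no unwanted box. *)

Require Import Defs.
From Stdlib Require Import Ensembles.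
From Stdlib Require Import Relations Lia Cantor Classical ClassicalEpsilon.

Set Implicit Arguments.
Unset Strict Implicit.

(** * The standard translation *)

(** The variable types are generalised because each modality binds a new variable of either sort.
    Translated modalities range over worlds twice, at the universal quantifier and at the
    implication; reflexivity and transitivity of [le] merge the two. *)
Lemma sat_st (M : structure) (phi : form) :
  forall (X A : Type) (x : X) (w : M) (rho : X -> carrier_s M)
    (sigma : A -> carrier_n M),
  sat w rho sigma (st A x phi) <-> holds w (rho x) phi.
Proof.
  destruct (le_order M) as [Hrefl Htrans _].
  induction phi as [i| |phi IH1 psi IH2|phi IH1 psi IH2|phi IH1 psi IH2
                    |phi IH|phi IH]; intros X A x w rho sigma; simpl.
  - tauto.
  - split; [|tauto]. intro H. exact (H w (Hrefl w) eq_refl).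
  - rewrite IH1, IH2. tauto.
  - rewrite IH1, IH2. tauto.
  - split; intros H w' Hw' Hphi; apply (IH2 X A x w' rho sigma), H; trivial;
      apply (IH1 X A x w' rho sigma), Hphi.
  - split; intros [a [Ha [HN H]]]; exists a; split; trivial; split; trivial.
    + intros w' Hw' y Hy HE.
      apply (IH _ _ None w' (extend rho y) (extend sigma a)).
      exact (H w' Hw' y Hy w' (Hrefl w') HE).
    + intros w' Hw' y Hy w'' Hw'' HE.
      apply (IH _ _ None w'' (extend rho y) (extend sigma a)), (H w''); trivial.
      * exact (Htrans _ _ _ Hw' Hw'').
      * exact (dom_s_incr Hw'' Hy).
  - split; intros H w' Hw' a Ha.
    + intro HN. destruct (H w' Hw' a Ha w' (Hrefl w') HN) as [y [Hy [HE Hs]]].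
      exists y. split; trivial. split; trivial.
      exact (proj1 (IH _ _ None w' (extend rho y) (extend sigma a)) Hs).
    + intros w'' Hw'' HN.
      destruct (H w'' (Htrans _ _ _ Hw' Hw'') a (dom_n_incr Hw'' Ha) HN)
        as [y [Hy [HE Hs]]].
      exists y. split; trivial. split; trivial.
      exact (proj2 (IH _ _ None w'' (extend rho y) (extend sigma a)) Hs).
Qed.

Lemma structure_st_consequence (Gamma : Ensemble form) (phi : form) :
  structure_consequence Gamma phi <-> st_consequence Gamma phi.
Proof.
  split; intros H M w d Hd HG.
  - apply sat_st, H; trivial. intros psi Hpsi.
    exact (proj1 (sat_st psi _ _ _ _) (HG psi Hpsi)).
  - apply (sat_st phi tt w (fun _ => d)
             (fun a : Datatypes.Empty_set => match a with end)).
    apply H; trivial. intros psi Hpsi. apply sat_st, HG, Hpsi.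
Qed.

(** * Soundness for structures *)

Lemma holds_persistent (M : structure) (phi : form) :
  forall (w w' : M) x, le w w' -> holds w x phi -> holds w' x phi.
Proof.
  destruct (le_order M) as [Hrefl Htrans _].
  induction phi as [i| |phi IH1 psi IH2|phi IH1 psi IH2|phi IH1 psi IH2
                    |phi IH|phi IH]; simpl; intros w w' x Hw H.
  - exact (int_P_incr Hw H).
  - exact H.
  - destruct H; split; eauto.
  - destruct H; eauto.
  - eauto.
  - destruct H as [a [Ha [HN H]]]. exists a. split; [exact (dom_n_incr Hw Ha)|].
    split; [exact (int_N_incr Hw HN)|eauto].
  - eauto.
Qed.

Lemma axiom_holds (phi : form) (M : structure) (w : M) (x : carrier_s M) :
  axiom phi -> holds w x phi.
Proof.
  pose proof (@holds_persistent M) as P.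
  destruct (le_order M) as [Hrefl Htrans _].
  destruct 1; simpl.
  - intros w1 H1 Hphi w2 H2 _. eauto.
  - intros w1 H1 Hf w2 H2 Hg w3 H3 Hphi. apply (Hf w3); eauto.
  - intros w1 H1 Hphi w2 H2 Hpsi. eauto.
  - tauto.
  - tauto.
  - tauto.
  - tauto.
  - intros w1 H1 Hf w2 H2 Hg w3 H3 [Hphi|Hpsi]; eauto.
  - tauto.
  - intros w1 H1 [[a [Ha [HN Hbox]]] Hdia].
    destruct (Hdia w1 (Hrefl w1) a Ha HN) as [y [Hy [HE Hneg]]]. eauto.
  - intros w1 H1 Himp w2 H2 a Ha HN.
    apply (Himp w2 H2) with (w' := w2) (a := a); trivial.
    (* The neighbourhood [a] under test itself witnesses [Box Top] at [w2]. *)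
    exists a. eauto.
Qed.

Lemma soundness (Gamma : Ensemble form) (phi : form) :
  calc Gamma phi -> structure_consequence Gamma phi.
Proof.
  induction 1 as [Gamma phi H|Gamma phi H|Gamma phi psi _ IH1 _ IH2
                  |Gamma phi psi _ IH|Gamma phi psi _ IH];
    intros M w d Hd HG.
  - exact (HG _ H).
  - exact (axiom_holds w d H).
  - destruct (le_order M) as [Hrefl _ _].
    exact (IH2 M w d Hd HG w (Hrefl w) (IH1 M w d Hd HG)).
  - destruct (le_order M) as [Hrefl _ _].
    intros w1 H1 [a [Ha [HN H]]]. exists a. split; trivial. split; trivial.
    intros w2 H2 y Hy HE.
    (* [IH] concerns the empty context, so it applies at the new element [y], where [Gamma] may
       fail. *)
    assert (Hi : holds w2 y (Imp phi psi))
      by (apply IH; [exact Hy|intros ? []]).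
    exact (Hi w2 (Hrefl w2) (H w2 H2 y Hy HE)).
  - destruct (le_order M) as [Hrefl _ _].
    intros w1 H1 H w2 H2 a Ha HN.
    destruct (H w2 H2 a Ha HN) as [y [Hy [HE Hs]]].
    exists y. split; trivial. split; trivial.
    assert (Hi : holds w2 y (Imp phi psi))
      by (apply IH; [exact Hy|intros ? []]).
    exact (Hi w2 (Hrefl w2) Hs).
Qed.

(** * From neighbourhood models to structures *)

Lemma inm_force_persistent (M : inm) (phi : form) :
  forall w w' : M, inm_le w w' -> inm_force w phi -> inm_force w' phi.
Proof.
  destruct (inm_le_order M) as [Hrefl Htrans _].
  induction phi as [i| |phi IH1 psi IH2|phi IH1 psi IH2|phi IH1 psi IH2
                    |phi IH|phi IH]; simpl; intros w w' Hw H.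
  - exact (inm_V_upset Hw H).
  - exact H.
  - destruct H; split; eauto.
  - destruct H; eauto.
  - eauto.
  - destruct H as [a [Ha [Hd H]]]. exists a. split; trivial.
    split; [exact (inm_N_dom Ha Hw Hd)|eauto].
  - eauto.
Qed.

(** [child b p v j] was born at [v] when the anchor of [b] was at [p];
    [nbhd x a p i] is a copy of [a] attached to [x] which came into being when
    [x] was at [p].  The indices [i] and [j] ensure freshness. *)
Inductive thread (W : Type) : Type :=
| root
| child (b : neighbourhood W) (p v : W) (j : nat)
with neighbourhood (W : Type) : Type :=
| nbhd (x : thread W) (a : pfun W) (p : W) (i : nat).

Arguments root {W}.

Definition below (W : Type) (n : nat) (x : thread W) : Prop :=
  match x with
  | root => True
  | child (nbhd _ _ _ i) _ _ j => i < n /\ j < n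
  end.

(** An older child may have moved away from [v]; the existential [j] provides one that stands at [v]
    itself. *)
Definition saturated (M : inm) (n : nat) (pos : thread M -> M -> Prop) : Prop :=
  forall x p a q i v, pos x p -> a ∈ inm_N M -> i < n -> v ∈ app a p ->
    exists j, pos (child (nbhd x a q i) p v j) v.

Record position (M : inm) : Type := {
  level : nat;
  pos : thread M -> M -> Prop;
  pos_fun : forall x p q, pos x p -> pos x q -> p = q;
  pos_below : forall x p, pos x p -> below (S level) x;
  pos_saturated : saturated (S level) pos
}.

(** Requiring the level to increase strictly makes antisymmetry independent of
    extensionality. *)
Definition position_le (M : inm) : relation (position M) :=
  fun w w' => w = w' \/
    level w < level w' /\
    forall x p, pos w x p -> exists p', pos w' x p' /\ inm_le p p'.

Lemma position_le_pos (M : inm) (w w' : position M) x p :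
  position_le w w' -> pos w x p -> exists p', pos w' x p' /\ inm_le p p'.
Proof.
  destruct (inm_le_order M) as [Hrefl _ _].
  intros [<-|[_ H]] Hp; eauto.
Qed.

Lemma position_le_level (M : inm) (w w' : position M) :
  position_le w w' -> level w <= level w'.
Proof. intros [<-|[H _]]; lia. Qed.

Lemma position_le_order (M : inm) : order (position M) (@position_le M).
Proof.
  destruct (inm_le_order M) as [_ Htrans _]. split.
  - intro w. left. reflexivity.
  - intros w1 w2 w3 H12 H23. destruct H12 as [<-|[L12 H12]]; trivial.
    destruct H23 as [<-|[L23 H23]]; [right; auto|].
    right. split; [lia|]. intros x p Hp.
    destruct (H12 x p Hp) as [p2 [Hp2 Hle2]].
    destruct (H23 x p2 Hp2) as [p3 [Hp3 Hle3]]. eauto.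
  - intros w1 w2 [H|[H _]] [H'|[H' _]]; subst; trivial; lia.
Qed.

(** Recursion through [moved_born] lets newborn threads have children at once, so one inductive
    closure achieves saturation. All births of one move carry the stamp [n]. *)
Inductive moved (M : inm) (old : thread M -> M -> Prop) (x : thread M) (p : M)
    (n : nat) : thread M -> M -> Prop :=
| moved_here : moved old x p n x p
| moved_kept y q : y <> x -> old y q -> moved old x p n y q
| moved_born y q a r i v :
    moved old x p n y q -> a ∈ inm_N M -> i <= n -> v ∈ app a q ->
    moved old x p n (child (nbhd y a r i) q v n) v.

Section Move.

Variables (M : inm) (old : thread M -> M -> Prop).
Variables (x : thread M) (p : M) (n : nat).
Hypothesis old_fun : forall y q r, old y q -> old y r -> q = r.
Hypothesis old_below : forall y q, old y q -> below n y.
Hypothesis x_below : below n x.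

(** Newborns carry the stamp [n], whereas [x] and the old threads lie below [n], so the constructors
    never overlap; the position of a newborn is written in its name. *)
Lemma moved_fun y q r :
  moved old x p n y q -> moved old x p n y r -> q = r.
Proof.
  destruct 1 as [|y q Hne Hq|y q a u i v Hy Ha Hi Hv]; intro H.
  - inversion H; subst; trivial; [congruence|]. simpl in x_below. lia.
  - inversion H; subst; trivial; [congruence|eauto|].
    apply old_below in Hq. simpl in Hq. lia.
  - inversion H; subst; trivial.
    + simpl in x_below. lia.
    + match goal with Ho : old _ _ |- _ => apply old_below in Ho; simpl in Ho end.
      lia.
Qed.

Lemma below_weaken (W : Type) (k m : nat) (y : thread W) :
  k <= m -> below k y -> below m y.
Proof. intro H. destruct y as [|[y a r i] q v j]; simpl; lia. Qed.

Lemma moved_below y q : moved old x p n y q -> below (S n) y.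
Proof.
  destruct 1 as [|y q Hne Hq|y q a u i v Hy Ha Hi Hv].
  - apply (@below_weaken _ n); trivial; lia.
  - apply (@below_weaken _ n); eauto; lia.
  - simpl. lia.
Qed.

Lemma moved_saturated : saturated (S n) (moved old x p n).
Proof.
  intros y q a r i v Hy Ha Hi Hv. exists n. apply moved_born; trivial. lia.
Qed.

Definition move : position M :=
  {| level := n; pos := moved old x p n; pos_fun := moved_fun;
     pos_below := moved_below; pos_saturated := moved_saturated |}.

Lemma moved_self q : moved old x p n x q -> q = p.
Proof. intro H. exact (moved_fun H (moved_here _ _ _ _)). Qed.

(** A copy of [a] stamped [n] has no members from before the move, so all of them are born at the
    new position of [x]. *)
Lemma moved_fresh_child a r q v j u :
  moved old x p n (child (nbhd x a r n) q v j) u ->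
  q = p /\ u = v /\ v ∈ app a p.
Proof.
  pose proof moved_self as Hself.
  intro H. inversion H as [E| |]; subst.
  (* Here [x] would be its own child, with the stamp [n] excluded by [x_below]. *)
  - rewrite E in x_below. simpl in x_below. lia.
  - match goal with Ho : old _ _ |- _ => apply old_below in Ho; simpl in Ho end.
    lia.
  - match goal with Hm : moved _ _ _ _ x q |- _ => apply Hself in Hm end.
    subst. auto.
Qed.

End Move.

Lemma move_above (M : inm) (w : position M) x p q :
  pos w x p -> inm_le p q ->
  exists w' : position M, position_le w w' /\ pos w' x q /\
    forall a r u v j s,
      pos w' (child (nbhd x a r (level w')) u v j) s -> s = v /\ v ∈ app a q.
Proof.
  destruct (inm_le_order M) as [Hrefl _ _].
  intros Hp Hpq.
  assert (Hx : below (S (level w)) x) by exact (pos_below Hp).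
  exists (move q (@pos_fun M w) (@pos_below M w) Hx).
  split; [right; split; [simpl; lia|]|split].
  - intros y r Hr. destruct (classic (y = x)) as [->|Hne].
    + rewrite (pos_fun Hr Hp). exists q. split; trivial. constructor.
    + exists r. split; trivial. apply moved_kept; trivial.
  - constructor.
  - simpl. intros a r u v j s H.
    apply (moved_fresh_child (@pos_fun M w) (@pos_below M w) Hx) in H. tauto.
Qed.

Definition initial_position (M : inm) (p : M) : position M.
Proof.
  refine (@move M (fun _ _ => False) root p 0 _ _ I); simpl; tauto.
Defined.

Lemma initial_position_root (M : inm) (p : M) : pos (initial_position p) root p.
Proof. constructor. Qed.

(** Recording the birth point [q] rather than the current point makes the relation persist: domains
    are upsets, so [a] stays defined at all later positions of [x]. *)
Definition thread_N (M : inm) (w : position M) (x : thread M)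
    (b : neighbourhood M) : Prop :=
  match b with
  | nbhd y a q i => y = x /\ a ∈ inm_N M /\ i < S (level w) /\ q ∈ dom a /\
      exists p, pos w x p /\ inm_le q p
  end.

(** The conjunct [inm_le v r] is imposed here because a [position] does not itself guarantee that a
    child stands above its birthplace. *)
Definition thread_E (M : inm) (w : position M) (b : neighbourhood M)
    (y : thread M) : Prop :=
  match b with
  | nbhd _ a q _ => exists p v j r, y = child b p v j /\ inm_le q p /\
      v ∈ app a p /\ pos w y r /\ inm_le v r
  end.

Definition thread_structure (M : inm) : structure.
Proof.
  refine {|
    world := position M;
    le := @position_le M;
    le_order := position_le_order M;
    carrier_s := thread M;
    carrier_n := neighbourhood M;
    dom_s := fun w x => exists p, pos w x p;
    dom_n := fun _ => Full_set _;
    int_N := @thread_N M;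
    int_E := @thread_E M;
    int_P := fun i w x => exists p, pos w x p /\ p ∈ inm_V M i |}.
  - intros w w' Hw x [p Hp].
    destruct (position_le_pos Hw Hp) as [q [Hq _]]. exists q. exact Hq.
  - intros w w' Hw b _. constructor.
  - intros w x [y a q i] [_ [_ [_ [_ [p [Hp _]]]]]].
    split; [exists p; exact Hp|constructor].
  - intros w [y a q i] x [p [v [j [r [_ [_ [_ [Hr _]]]]]]]].
    split; [constructor|exists r; exact Hr].
  - intros i w x [p [Hp _]]. exists p. exact Hp.
  - intros w w' x [y a q i] Hw [Hy [Ha [Hi [Hq [p [Hp Hqp]]]]]].
    destruct (position_le_pos Hw Hp) as [p' [Hp' Hle]].
    pose proof (position_le_level Hw) as Hl.
    destruct (inm_le_order M) as [_ Htrans _].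
    repeat split; trivial; [lia|]. exists p'. eauto.
  - intros w w' [y a q i] x Hw [p [v [j [r [Hx [Hq [Hv [Hr Hle]]]]]]]].
    destruct (position_le_pos Hw Hr) as [r' [Hr' Hle']].
    destruct (inm_le_order M) as [_ Htrans _].
    exists p, v, j, r'. repeat split; trivial. eauto.
  - intros i w w' Hw x [p [Hp HV]].
    destruct (position_le_pos Hw Hp) as [p' [Hp' Hle]].
    exists p'. split; trivial. exact (inm_V_upset Hle HV).
Defined.

Lemma thread_structure_holds (M : inm) (phi : form) :
  forall (w : position M) x p, pos w x p ->
  (@holds (thread_structure M) w x phi <-> inm_force p phi).
Proof.
  destruct (inm_le_order M) as [Hrefl Htrans _].
  induction phi as [i| |phi IH1 psi IH2|phi IH1 psi IH2|phi IH1 psi IH2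
                    |phi IH|phi IH]; intros w x p Hp; simpl.
  - split.
    + intros [q [Hq HV]]. rewrite (pos_fun Hp Hq). exact HV.
    + intro HV. exists p. auto.
  - tauto.
  - rewrite (IH1 w x p Hp), (IH2 w x p Hp). tauto.
  - rewrite (IH1 w x p Hp), (IH2 w x p Hp). tauto.
  - split.
    + intros H q Hpq Hphi. destruct (move_above Hp Hpq) as [w' [Hw [Hq _]]].
      apply (IH2 w' x q Hq), H; trivial. apply (IH1 w' x q Hq), Hphi.
    + intros H w' Hw Hphi. destruct (position_le_pos Hw Hp) as [q [Hq Hpq]].
      apply (IH2 w' x q Hq), H; trivial. apply (IH1 w' x q Hq), Hphi.
  - split.
    + intros [[y a r i] [_ [[-> [Ha [Hi [Hr [p' [Hp' Hle]]]]]] H]]].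
      rewrite <- (pos_fun Hp Hp') in Hle. exists a. split; trivial.
      split; [exact (inm_N_dom Ha Hle Hr)|]. intros q Hpq v Hv.
      (* Once [x] has moved to [q], saturation supplies a child standing exactly at [v], where the
         box can be applied. *)
      destruct (move_above Hp Hpq) as [w' [Hw [Hq _]]].
      assert (Hi' : i < S (level w')) by (apply position_le_level in Hw; lia).
      destruct (@pos_saturated M w' x q a r i v Hq Ha Hi' Hv) as [j Hj].
      apply (IH w' _ v Hj). apply (H w' Hw); [exists v; exact Hj|].
      exists q, v, j, v. repeat split; eauto.
    (* Stamp 0 is legal at every level. Birth point [p] confines members to children born at points
       of [a] above [p], and persistence covers their later moves. *)
    + intros [a [Ha [Hd H]]]. exists (nbhd x a p 0). split; [constructor|].
      split; [repeat split; trivial; [lia|eauto]|].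
      intros w' Hw y _ [q [v [j [r [_ [Hpq [Hv [Hr Hvr]]]]]]]].
      apply (IH w' y r Hr). apply (inm_force_persistent Hvr). eauto.
  - split.
    + intros H q Hpq a Ha Hd.
      destruct (move_above Hp Hpq) as [w' [Hw [Hq Hfresh]]].
      (* An older copy may contain children born at earlier positions of [x], outside the value of
         [a] at [q]; the copy stamped with the current level cannot. *)
      destruct (H w' Hw (nbhd x a q (level w'))) as [y [_ [HE Hy]]];
        [constructor|repeat split; trivial; [lia|eauto]|].
      destruct HE as [u [v [j [s [-> [_ [_ [Hs _]]]]]]]].
      destruct (Hfresh _ _ _ _ _ _ Hs) as [-> Hv].
      exists v. split; trivial. apply (IH w' _ v Hs), Hy.
    + intros H w' Hw [y a r i] _ [-> [Ha [Hi [Hr [q [Hq Hrq]]]]]].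
      destruct (position_le_pos Hw Hp) as [q' [Hq' Hpq]].
      rewrite <- (pos_fun Hq Hq') in Hpq.
      destruct (H q Hpq a Ha (inm_N_dom Ha Hrq Hr)) as [v [Hv Hphi]].
      destruct (@pos_saturated M w' x q a r i v Hq Ha Hi Hv) as [j Hj].
      eexists. split; [exists v; exact Hj|]. split.
      * exists q, v, j, v. repeat split; eauto.
      * apply (IH w' _ v Hj), Hphi.
Qed.

Lemma structure_inm_consequence (Gamma : Ensemble form) (phi : form) :
  structure_consequence Gamma phi -> inm_consequence Gamma phi.
Proof.
  intros H M p HG. pose proof (initial_position_root p) as Hp.
  apply (thread_structure_holds phi Hp). apply H; [exists p; exact Hp|].
  intros psi Hpsi. apply (thread_structure_holds psi Hp). auto.
Qed.

(** * The calculus and prime theories *)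

Lemma calc_weaken (Gamma Delta : Ensemble form) (phi : form) :
  calc Gamma phi -> Included _ Gamma Delta -> calc Delta phi.
Proof.
  intro H. revert Delta. induction H; intros Delta HD.
  - apply calc_el, HD; trivial.
  - apply calc_ax; trivial.
  - eapply calc_mp; eauto.
  - apply calc_mon_box; trivial.
  - apply calc_mon_dia; trivial.
Qed.

Lemma calc_imp_const (Gamma : Ensemble form) (phi psi : form) :
  calc Gamma psi -> calc Gamma (Imp phi psi).
Proof. intro H. apply (calc_mp H), calc_ax. constructor. Qed.

Lemma calc_imp_refl (Gamma : Ensemble form) (phi : form) :
  calc Gamma (Imp phi phi).
Proof.
  eapply calc_mp; [|eapply calc_mp; [|apply calc_ax, ax_S]];
    apply calc_ax, ax_K with (psi := phi) || apply calc_ax, ax_K.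
Qed.

(** The monotonicity rules cause no trouble: their premises are derived from the empty set and hence
    do not depend on [phi]. *)
Lemma deduction (Gamma : Ensemble form) (phi psi : form) :
  calc (Add _ Gamma phi) psi -> calc Gamma (Imp phi psi).
Proof.
  intro H. remember (Add _ Gamma phi) as Delta eqn:E.
  induction H as [Delta psi H|Delta psi H|Delta psi chi _ IH1 _ IH2
                  |Delta psi chi H _|Delta psi chi H _]; subst Delta.
  - destruct H as [psi H|psi []].
    + apply calc_imp_const, calc_el, H.
    + apply calc_imp_refl.
  - apply calc_imp_const, calc_ax, H.
  - apply (calc_mp (IH1 eq_refl)), (calc_mp (IH2 eq_refl)), calc_ax.
    constructor.
  - apply calc_imp_const, calc_mon_box, H.
  - apply calc_imp_const, calc_mon_dia, H.
Qed.

(** * Formula codes and the Lindenbaum construction *)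

Fixpoint code (phi : form) : nat :=
  match phi with
  | Var i => to_nat (0, i)
  | Bot => to_nat (1, 0)
  | And phi psi => to_nat (2, to_nat (code phi, code psi))
  | Or phi psi => to_nat (3, to_nat (code phi, code psi))
  | Imp phi psi => to_nat (4, to_nat (code phi, code psi))
  | Box phi => to_nat (5, code phi)
  | Dia phi => to_nat (6, code phi)
  end.

Lemma to_nat_pair_inj (a b c d : nat) :
  to_nat (a, b) = to_nat (c, d) -> a = c /\ b = d.
Proof. intro H. apply to_nat_inj in H. injection H. auto. Qed.

Lemma code_inj (phi psi : form) : code phi = code psi -> phi = psi.
Proof.
  revert psi.
  induction phi as [i| |phi IH1 phi' IH2|phi IH1 phi' IH2|phi IH1 phi' IH2
                    |phi IH|phi IH];
    intros [k| |psi psi'|psi psi'|psi psi'|psi|psi] H;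
    cbn [code] in H; apply to_nat_pair_inj in H as [Htag H];
    try discriminate Htag; try apply to_nat_pair_inj in H as [H1 H2];
    f_equal; auto.
Qed.

Definition closed (T : Ensemble form) : Prop :=
  forall phi, calc T phi -> phi ∈ T.

Definition prime (T : Ensemble form) : Prop :=
  closed T /\ ~ Bot ∈ T /\
  forall phi psi, Or phi psi ∈ T -> phi ∈ T \/ psi ∈ T.

Section Lindenbaum.

Variables (Gamma : Ensemble form) (theta : form).

(** Step [n] considers the formula coded by [n]; a number that codes no formula leaves the stage
    unchanged. *)
Fixpoint stage (n : nat) : Ensemble form :=
  match n with
  | 0 => Gamma
  | S n => fun phi => stage n phi \/
      code phi = n /\ ~ calc (Add _ (stage n) phi) theta
  end.

Definition limit : Ensemble form := fun phi => exists n, stage n phi.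

Lemma stage_incr (m n : nat) : m <= n -> Included _ (stage m) (stage n).
Proof.
  induction 1; intros phi Hphi; [exact Hphi|]. left. exact (IHle phi Hphi).
Qed.

Lemma limit_compact (phi : form) :
  calc limit phi -> exists n, calc (stage n) phi.
Proof.
  intro H. remember limit as Delta eqn:E.
  induction H as [Delta psi H|Delta psi H|Delta psi chi _ IH1 _ IH2
                  |Delta psi chi H _|Delta psi chi H _]; subst Delta.
  - destruct H as [n Hn]. exists n. apply calc_el, Hn.
  - exists 0. apply calc_ax, H.
  - destruct (IH1 eq_refl) as [m Hm], (IH2 eq_refl) as [n Hn]. exists (m + n).
    apply calc_mp with psi.
    + apply (calc_weaken Hm), stage_incr. lia.
    + apply (calc_weaken Hn), stage_incr. lia.
  - exists 0. apply calc_mon_box, H.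
  - exists 0. apply calc_mon_dia, H.
Qed.

Hypothesis Gamma_theta : ~ calc Gamma theta.

Lemma stage_avoids (n : nat) : ~ calc (stage n) theta.
Proof.
  induction n as [|n IH]; [exact Gamma_theta|]. intro H.
  destruct (classic (exists phi,
    code phi = n /\ ~ calc (Add _ (stage n) phi) theta)) as [[phi [Hc Hn]]|Hno].
  - apply Hn, (calc_weaken H). intros psi [Hpsi|[Hpsi _]].
    + left. exact Hpsi.
    (* Injectivity of [code] makes [phi] the only formula that this step can add. *)
    + right. rewrite (@code_inj phi psi); [constructor|congruence].
  - apply IH, (calc_weaken H). intros psi [Hpsi|Hpsi]; [exact Hpsi|].
    destruct Hno. exists psi. exact Hpsi.
Qed.

Lemma limit_avoids : ~ calc limit theta.
Proof.
  intro H. destruct (limit_compact H) as [n Hn]. exact (stage_avoids Hn).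
Qed.

(** A missing formula was rejected at the step of its own code, because adding it made [theta]
    derivable. *)
Lemma limit_maximal (phi : form) : ~ phi ∈ limit -> calc limit (Imp phi theta).
Proof.
  intro H. apply deduction. apply NNPP. intro Hn. apply H.
  exists (S (code phi)). right. split; trivial.
  intro Hc. apply Hn, (calc_weaken Hc).
  intros psi Hpsi. destruct Hpsi as [psi Hpsi|psi []].
  - left. exists (code phi). exact Hpsi.
  - right. constructor.
Qed.

Lemma limit_closed : closed limit.
Proof.
  intros phi H. apply NNPP. intro Hn.
  exact (limit_avoids (calc_mp H (limit_maximal Hn))).
Qed.

Lemma limit_prime : prime limit.
Proof.
  split; [exact limit_closed|]. split.
  - intro H. apply limit_avoids. apply calc_mp with Bot; [apply calc_el, H|].
    apply calc_ax. constructor.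
  - intros phi psi H. apply NNPP. intro Hn. apply not_or_and in Hn as [H1 H2].
    apply limit_avoids. apply calc_mp with (Or phi psi); [apply calc_el, H|].
    apply (calc_mp (limit_maximal H2)), (calc_mp (limit_maximal H1)), calc_ax.
    constructor.
Qed.

End Lindenbaum.

Lemma lindenbaum (Gamma : Ensemble form) (theta : form) :
  ~ calc Gamma theta ->
  exists T, prime T /\ Included _ Gamma T /\ ~ theta ∈ T.
Proof.
  intro H. exists (limit Gamma theta). split; [exact (limit_prime H)|]. split.
  - intros phi Hphi. exists 0. exact Hphi.
  - intro Ht. exact (limit_avoids H (calc_el Ht)).
Qed.

Lemma closed_mp (T : Ensemble form) (phi psi : form) :
  closed T -> calc T (Imp phi psi) -> phi ∈ T -> psi ∈ T.
Proof. intros HT H Hphi. apply HT. exact (calc_mp (calc_el Hphi) H). Qed.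

(** Otherwise [psi] provably implies [Neg phi]; monotonicity of [Dia] then puts [Dia (Neg phi)] into
    [T], against [Box phi] and [ax_box_dia_neg]. *)
Lemma box_dia_compatible (T : Ensemble form) (phi psi : form) :
  prime T -> Box phi ∈ T -> Dia psi ∈ T ->
  exists S, prime S /\ phi ∈ S /\ psi ∈ S.
Proof.
  intros [HT [Hbot _]] Hphi Hpsi.
  destruct (@lindenbaum (Add _ (Add _ (Empty_set _) psi) phi) Bot)
    as [S [HS [Hin _]]].
  - intro H. apply deduction, deduction in H. apply Hbot.
    assert (Hn : Dia (Neg phi) ∈ T)
      by exact (closed_mp HT (calc_mon_dia T H) Hpsi).
    apply HT. eapply calc_mp; [|apply calc_ax, (ax_box_dia_neg phi)].
    apply (calc_mp (calc_el Hn)), (calc_mp (calc_el Hphi)), calc_ax.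
    constructor.
  - exists S. split; trivial. split; apply Hin.
    + right. constructor.
    + left. right. constructor.
Qed.

Lemma separate (phi psi : form) :
  ~ calc (Empty_set _) (Imp phi psi) ->
  exists S, prime S /\ phi ∈ S /\ ~ psi ∈ S.
Proof.
  intro H. destruct (@lindenbaum (Add _ (Empty_set _) phi) psi)
    as [S [HS [Hin Hn]]].
  - intro Hc. exact (H (deduction Hc)).
  - exists S. split; trivial. split; trivial. apply Hin. right. constructor.
Qed.

(** * The canonical neighbourhood model *)

Record cworld : Type := {
  theory : Ensemble form;
  rank : nat;
  theory_prime : prime theory
}.

(** Strict growth of the rank gives antisymmetry without comparing theories or primality proofs, and
    permits strict successors with the same theory. *)
Definition cle : relation cworld :=
  fun w w' => w = w' \/
    rank w < rank w' /\ Included _ (theory w) (theory w').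

Lemma cle_order : order cworld cle.
Proof.
  split.
  - intro w. left. reflexivity.
  - intros w1 w2 w3 [<-|[L12 H12]] [<-|[L23 H23]]; [left|right|right|right];
      auto. split; [lia|]. intros phi Hphi. auto.
  - intros w1 w2 [H|[H _]] [H'|[H' _]]; subst; trivial; lia.
Qed.

Lemma cle_theory (w w' : cworld) :
  cle w w' -> Included _ (theory w) (theory w').
Proof. intros [<-|[_ H]]; [intro; trivial|exact H]. Qed.

(** The two conditions are what the truth lemma demands of every neighbourhood:
    it must witness all diamonds and may not force new boxes. *)
Definition admissible (a : pfun cworld) : Prop :=
  upset cle (dom a) /\
  (forall w psi, w ∈ dom a -> Dia psi ∈ theory w ->
     exists v, v ∈ app a w /\ psi ∈ theory v) /\
  (forall w chi, w ∈ dom a -> ~ Box chi ∈ theory w ->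
     exists w' v, cle w w' /\ v ∈ app a w' /\ ~ chi ∈ theory v).

Definition canonical : inm.
Proof.
  refine {|
    inm_world := cworld;
    inm_le := cle;
    inm_le_order := cle_order;
    inm_N := admissible;
    inm_V := fun i w => Var i ∈ theory w |}.
  - intros a [Ha _]. exact Ha.
  - intros i w w' Hw H. exact (cle_theory Hw H).
Defined.

Lemma pfun_exists (W : Type) (D : Ensemble W) (F : W -> Ensemble W) :
  exists a : pfun W, (forall w, w ∈ dom a <-> w ∈ D) /\
    (forall w v, v ∈ app a w <-> w ∈ D /\ v ∈ F w).
Proof.
  exists (fun w => if excluded_middle_informative (w ∈ D)
                   then Some (F w) else None).
  unfold dom, app, In. split.
  - intro w. destruct (excluded_middle_informative _) as [H|H]; split;
      [trivial|exists (F w); trivial|intros [U HU]; discriminate|tauto].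
  - intros w v. destruct (excluded_middle_informative _) as [H|H]; split.
    + intros [U [HU Hv]]. injection HU as ->. auto.
    + intros [_ Hv]. exists (F w). auto.
    + intros [U [HU _]]. discriminate.
    + tauto.
Qed.

(** The value is constantly the set of worlds containing [phi]. If [Box chi] is missing where
    [Box phi] is present, then [phi] does not provably imply [chi], so some member omits [chi]. *)
Lemma box_nbhd (phi : form) :
  exists a, admissible a /\
    (forall w, w ∈ dom a <-> Box phi ∈ theory w) /\
    forall w v, v ∈ app a w -> phi ∈ theory v.
Proof.
  destruct (pfun_exists (fun w => Box phi ∈ theory w)
              (fun _ v => phi ∈ theory v)) as [a [Hd Ha]].
  exists a. split; [split; [|split]|split; trivial].
  - intros w w' Hw H. apply Hd. apply Hd in H. exact (cle_theory Hw H).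
  - intros w psi Hw Hpsi. apply Hd in Hw.
    destruct (box_dia_compatible (theory_prime w) Hw Hpsi) as [S [HS [H1 H2]]].
    (* Members of a neighbourhood need not be comparable with [w], so any rank would do; 0 is a
       default. *)
    exists {| theory := S; rank := 0; theory_prime := HS |}.
    split; trivial. apply Ha. split; trivial.
  - intros w chi Hw Hchi. apply Hd in Hw.
    destruct (@separate phi chi) as [S [HS [H1 H2]]].
    + intro H. apply Hchi.
      exact (closed_mp (proj1 (theory_prime w)) (calc_mon_box _ H) Hw).
    + exists w, {| theory := S; rank := 0; theory_prime := HS |}.
      split; [left; reflexivity|]. split; trivial. apply Ha. split; trivial.
  - intros w v H. apply Ha in H. exact (proj2 H).
Qed.

(** The value at [w] is the set of worlds omitting [phi]; elsewhere in the domain it is the set of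
    all worlds. At [w], any [Dia psi] present has a witness without [phi], since otherwise
    monotonicity would yield [Dia phi]. *)
Lemma dia_nbhd (w : cworld) (phi : form) :
  Box Top ∈ theory w -> ~ Dia phi ∈ theory w ->
  exists a, admissible a /\ w ∈ dom a /\
    forall v, v ∈ app a w -> ~ phi ∈ theory v.
Proof.
  intros Hbox Hdia.
  destruct (pfun_exists (fun w' => Box Top ∈ theory w')
              (fun w' v => w' = w -> ~ phi ∈ theory v)) as [a [Hd Ha]].
  exists a. split; [split; [|split]|split].
  - intros u u' Hu H. apply Hd. apply Hd in H. exact (cle_theory Hu H).
  - intros u psi Hu Hpsi. apply Hd in Hu.
    destruct (classic (u = w)) as [->|Hne].
    + destruct (@separate psi phi) as [S [HS [H1 H2]]].
      * intro H. apply Hdia.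
        exact (closed_mp (proj1 (theory_prime w)) (calc_mon_dia _ H) Hpsi).
      * exists {| theory := S; rank := 0; theory_prime := HS |}.
        split; trivial. apply Ha. split; trivial. intros _. exact H2.
    + destruct (box_dia_compatible (theory_prime u) Hu Hpsi) as [S [HS [_ H2]]].
      exists {| theory := S; rank := 0; theory_prime := HS |}.
      split; trivial. apply Ha. split; trivial. intro. contradiction.
  - intros u chi Hu Hchi. apply Hd in Hu.
    destruct (@separate Top chi) as [S [HS [_ H2]]].
    + intro H. apply Hchi.
      exact (closed_mp (proj1 (theory_prime u)) (calc_mon_box _ H) Hu).
    (* This rank exceeds that of [u], so the copy lies above [u], and that of [w], so the copy
       differs from [w] and its neighbours are unrestricted. *)
    + exists {| theory := theory u; rank := 1 + rank u + rank w;
                theory_prime := theory_prime u |},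
             {| theory := S; rank := 0; theory_prime := HS |}.
      split; [right; split; [simpl; lia|intro; trivial]|].
      split; trivial. apply Ha. split; trivial. intros E.
      apply (f_equal rank) in E. simpl in E. lia.
  - apply Hd, Hbox.
  - intros v H. apply Ha in H. exact (proj2 H eq_refl).
Qed.

Lemma imp_extension (w : cworld) (phi psi : form) :
  ~ Imp phi psi ∈ theory w ->
  exists w', cle w w' /\ phi ∈ theory w' /\ ~ psi ∈ theory w'.
Proof.
  intro H.
  destruct (@lindenbaum (Add _ (theory w) phi) psi) as [T [HT [Hin Hn]]].
  - intro Hc. apply H, (proj1 (theory_prime w)), deduction, Hc.
  - exists {| theory := T; rank := S (rank w); theory_prime := HT |}.
    split; [|split; trivial].
    + right. split; [simpl; lia|]. intros chi Hchi. apply Hin. left. exact Hchi.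
    + apply Hin. right. constructor.
Qed.

Lemma truth (phi : form) :
  forall w : cworld, @inm_force canonical w phi <-> phi ∈ theory w.
Proof.
  induction phi as [i| |phi IH1 psi IH2|phi IH1 psi IH2|phi IH1 psi IH2
                    |phi IH|phi IH]; intro w; simpl;
    pose proof (theory_prime w) as [HT [Hbot Hor]].
  - tauto.
  - tauto.
  - rewrite IH1, IH2. split.
    + intros [H1 H2]. apply HT. apply (calc_mp (calc_el H2)).
      apply (calc_mp (calc_el H1)), calc_ax. constructor.
    + intro H. split; refine (closed_mp HT _ H); apply calc_ax; constructor.
  - rewrite IH1, IH2. split; [|auto].
    intros [H|H]; refine (closed_mp HT _ H); apply calc_ax; constructor.
  - split.
    + intro H. apply NNPP. intro Hn.
      destruct (imp_extension Hn) as [w' [Hw [H1 H2]]].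
      apply H2, IH2, H; trivial. apply IH1, H1.
    + intros H w' Hw H1. apply IH2. apply IH1 in H1.
      exact (closed_mp (proj1 (theory_prime w'))
               (calc_el (cle_theory Hw H)) H1).
  - split.
    + intros [a [[_ [_ Ha]] [Hd H]]]. apply NNPP. intro Hn.
      destruct (Ha w phi Hd Hn) as [w' [v [Hw [Hv Hphi]]]].
      apply Hphi, IH. exact (H w' Hw v Hv).
    + intro H. destruct (box_nbhd phi) as [a [Ha [Hd Hv]]].
      exists a. split; trivial. split; [apply Hd, H|].
      intros w' _ v Hin. apply IH. exact (Hv w' v Hin).
  - split.
    + intro H. apply NNPP. intro Hn.
      (* By [ax_box_top_dia], a missing [Dia phi] can be refuted at an extension containing
         [Box Top], which the domain of the neighbourhood from [dia_nbhd] requires. *)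
      assert (Hn' : ~ Imp (Box Top) (Dia phi) ∈ theory w).
      { intro Hi. apply Hn.
        refine (closed_mp HT _ Hi). apply calc_ax. constructor. }
      destruct (imp_extension Hn') as [w' [Hw [Hbox Hdia]]].
      destruct (dia_nbhd Hbox Hdia) as [a [Ha [Hd Hv]]].
      destruct (H w' Hw a Ha Hd) as [v [Hin Hphi]].
      exact (Hv v Hin (proj1 (IH v) Hphi)).
    + intros H w' Hw a [_ [Ha _]] Hd.
      destruct (Ha w' phi Hd (cle_theory Hw H)) as [v [Hv Hphi]].
      exists v. split; trivial. apply IH, Hphi.
Qed.

Lemma completeness (Gamma : Ensemble form) (phi : form) :
  inm_consequence Gamma phi -> calc Gamma phi.
Proof.
  intro H. apply NNPP. intro Hn.
  destruct (lindenbaum Hn) as [T [HT [Hin Hphi]]].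
  pose (w := {| theory := T; rank := 0; theory_prime := HT |}).
  apply Hphi. apply (truth phi w). apply (H canonical w).
  intros psi Hpsi. apply truth. exact (Hin psi Hpsi).
Qed.

Theorem theorem3p40 (Gamma : Ensemble form) (phi : form) :
  (calc Gamma phi <-> inm_consequence Gamma phi) /\
  (inm_consequence Gamma phi <-> structure_consequence Gamma phi) /\
  (structure_consequence Gamma phi <-> st_consequence Gamma phi).
Proof.
  pose proof (@soundness Gamma phi). pose proof (@completeness Gamma phi).
  pose proof (@structure_inm_consequence Gamma phi).
  pose proof (structure_st_consequence Gamma phi). tauto.
Qed.
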